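(* Let $n\ge 1$, let $W$ be a symmetric positive definite real $n\times n$ matrix, let $a<b$ be real numbers, and let $m\ge 0$, $M>0$ and $\nu_m\ge 0$ be integers satisfying $m+\nu_m\le M-1$. Then for every continuous $f:[a,b]\to\mathbf{R}^n$ the functional $$J_{W,m,a,b}(f)=\int_a^b\left(\frac{s-a}{b-a}\right)^m f(s)^T W f(s)\,ds$$ satisfies $$J_{W,m,a,b}(f)\ \ge\ \frac{1}{b-a}\,\Phi_M^T\,(\Xi_m\otimes I)^T\,\mathcal{W}_m\,(\Xi_m\otimes I)\,\Phi_M ,$$ where $I$ is the $n\times n$ identity matrix, $\mathcal{W}_m=\mathrm{diag}\{m+1,\,m+3,\,\ldots,\,m+2\nu_m+1\}\otimes W$, and $\Phi_M^T=[\phi_0^T,\ldots,\phi_{M-1}^T]$ with $\phi_l=\int_a^b p_{0,l}(s)f(s)\,ds$; the polynomials $p_{0,l}$ and the matrix $\Xi_m\in\mathbf{R}^{(\nu_m+1)\times M}$ are defined in the context.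
   Context: $\otimes$ denotes the Kronecker product. For integers $m,n\ge 0$ define polynomials of degree $n$ by $P_{m,0}(x)\equiv 1$ and $$P_{m,n}(x)=\frac{1}{n!}\,\frac{1}{x^m}\,\frac{d^n}{dx^n}\left(x^m(x^2-x)^n\right),\quad n=1,2,\ldots$$ (for fixed $m$ these are orthogonal on $[0,1]$ with weight $x^m$). On $[a,b]$ put $p_{m,n}(t)=P_{m,n}\left(\frac{t-a}{b-a}\right)$. For $j=0,\ldots,\nu_m$ let $q_{m,m+j}(x)=x^mP_{m,j}(x)$, a polynomial of degree $m+j\le M-1$, and let $\xi^m_{j,l}$ ($0\le l\le M-1$) be its coefficients in the basis $P_{0,0},\ldots,P_{0,M-1}$: $$q_{m,m+j}(x)=\sum_{l=0}^{M-1}\xi^m_{j,l}P_{0,l}(x)$$ (so $\xi^m_{j,l}=0$ if $m+j<l\le M-1$). $\Xi_m\in\mathbf{R}^{(\nu_m+1)\times M}$ is the matrix whose rows are $\underline{\xi}^m_j=(\xi^m_{j,0},\ldots,\xi^m_{j,M-1})$, $j=0,\ldots,\nu_m$. *)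

(* Defs.v *)
From HB Require Import structures.
From mathcomp Require Import all_boot all_order all_algebra.
From mathcomp Require Export mxtens.
From mathcomp Require Import all_classical all_reals all_analysis.
Import numFieldNormedType.Exports.

Set Implicit Arguments.
Unset Strict Implicit.
Unset Printing Implicit Defensive.

Import Order.TTheory GRing.Theory Num.Theory.
Local Open Scope ring_scope.

Section Jacobi.
Variable R : numFieldType.

(* Shifted Jacobi polynomials P_{m,n}, by the Rodrigues formula.  The division
   by 'X^m is exact, see [jacobiM]. *)
Definition jacobi (m n : nat) : {poly R} :=
  (n`!%:R)^-1 *: ((('X^m * ('X^2 - 'X) ^+ n)^`(n)) %/ 'X^m).

Let rodrigues (m n : nat) : {poly R} := ('X^m * ('X^2 - 'X) ^+ n)^`(n).

Let coef_rodrigues m n i :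
  (rodrigues m n)`_i =
  if (i < m)%N then 0
  else (('X - 1%:P : {poly R}) ^+ n)`_(i - m) *+ (n + i) ^_ n.
Proof.
rewrite /rodrigues coef_derivn.
have -> : 'X^2 - 'X = 'X * ('X - 1%:P) :> {poly R}.
  by rewrite mulrBr mulr1 expr2.
rewrite exprMn mulrA -exprD coefXnM [(m + n)%N]addnC ltn_add2l.
by case: ifP => _; rewrite ?mul0rn // subnDl.
Qed.

Lemma rodrigues_dvd m n :
  'X^m %| (('X^m * ('X^2 - 'X) ^+ n)^`(n) : {poly R}).
Proof.
rewrite -/(rodrigues m n) -[rodrigues m n](poly_take_drop m).
suff -> : take_poly m (rodrigues m n) = 0 by rewrite add0r dvdp_mull.
by apply/polyP => i; rewrite coef_take_poly coef0 coef_rodrigues; case: ifP => // ->.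
Qed.

Lemma jacobiM m n :
  jacobi m n * 'X^m = (n`!%:R)^-1 *: ('X^m * ('X^2 - 'X) ^+ n)^`(n).
Proof. by rewrite /jacobi -scalerAl divpK // rodrigues_dvd. Qed.

Lemma jacobi0 m : jacobi m 0 = 1.
Proof.
rewrite /jacobi invr1 scale1r expr0 mulr1 derivn0.
by rewrite divpp ?monic_neq0 ?monicXn.
Qed.

Let coef_jacobi m n i : (jacobi m n)`_i =
  (n`!%:R)^-1 * ((('X - 1%:P : {poly R}) ^+ n)`_i *+ (n + (m + i)) ^_ n).
Proof.
have : (jacobi m n * 'X^m)`_(m + i) = (jacobi m n)`_i.
  by rewrite coefMXn ltnNge leq_addr /= addKn.
move=> <-; rewrite jacobiM coefZ -/(rodrigues m n) coef_rodrigues.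
by rewrite ltnNge leq_addr /= addKn.
Qed.

Lemma size_jacobi m n : size (jacobi m n) = n.+1.
Proof.
have sz : size (('X - 1%:P : {poly R}) ^+ n) = n.+1 by rewrite size_exp_XsubC.
apply/eqP; rewrite eqn_leq; apply/andP; split.
  apply/leq_sizeP => j ltnj.
  by rewrite coef_jacobi nth_default ?sz // mul0rn mulr0.
rewrite ltnNge; apply/negP => /leq_sizeP/(_ n (leqnn n)).
rewrite coef_jacobi.
have -> : (('X - 1%:P : {poly R}) ^+ n)`_n = 1.
  have /monicP := monic_exp n (monicXsubC (1 : R)).
  by rewrite lead_coefE sz.
apply/eqP; rewrite mulf_neq0 ?invr_neq0 ?pnatr_eq0 -?lt0n ?fact_gt0 //.
by rewrite ffact_gt0 leq_addr.
Qed.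

Definition legendre_tuple (M : nat) : M.-tuple {poly_M R} :=
  [tuple npolyp M (jacobi 0 l) | l < M].

Lemma legendre_tupleE M (l : 'I_M) :
  (legendre_tuple M)`_l = jacobi 0 l :> {poly R}.
Proof.
by rewrite -tnth_nth tnth_mktuple npolypK // size_jacobi.
Qed.

Lemma legendre_basis M : basis_of fullv (legendre_tuple M).
Proof.
rewrite basisEfree subvf size_tuple dim_polyn leqnn !andbT.
apply/freeP => u u0.
have {}u0 : \sum_(l < M) u l *: jacobi 0 l = 0.
  transitivity (polyn (\sum_(l < M) u l *: (legendre_tuple M)`_l)).
    rewrite raddf_sum /=; apply: eq_bigr => l _.
    by rewrite -(legendre_tupleE l).
  by rewrite u0.
have main k : forall l : 'I_M, (M - k <= l)%N -> u l = 0.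
  elim: k => [|k IH] l; first by rewrite subn0 leqNgt ltn_ord.
  move=> Mkl; have [/IH //|lMk] := leqP (M - k) l.
  have := congr1 (fun p : {poly R} => p`_l) u0.
  rewrite coef0 coef_sum (bigD1 l) //= big1 ?addr0; last first.
    move=> i neq_il; rewrite coefZ.
    have [il|li] := ltnP i l.
      by rewrite [_`_l]nth_default ?size_jacobi ?mulr0.
    rewrite IH ?mul0r //.
    have {}li : (l < i)%N by rewrite ltn_neqAle li andbT eq_sym.
    apply: leq_trans li.
    by move: Mkl lMk; rewrite subnS; case: (M - k)%N.
  move/eqP; rewrite coefZ mulf_eq0 => /orP[/eqP //|].
  have : lead_coef (jacobi 0 l) != 0.
    by rewrite lead_coef_eq0 -size_poly_eq0 size_jacobi.
  by rewrite lead_coefE size_jacobi /= => /negPf ->.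
by move=> l; apply: (main M); rewrite subnn.
Qed.

(* [npolyp M] truncates to degree < M; it is the identity here as soon as
   m + nu < M, see [legendre_mxP]. *)
Definition legendre_mx (m nu M : nat) : 'M[R]_(nu.+1, M) :=
  \matrix_(j, l) coord (legendre_tuple M) l (npolyp M ('X^m * jacobi m j)).

Lemma legendre_mxP (m nu M : nat) (j : 'I_nu.+1) : (m + nu < M)%N ->
  'X^m * jacobi m j = \sum_(l < M) legendre_mx m nu M j l *: jacobi 0 l.
Proof.
move=> mnuM.
have szq : (size ('X^m * jacobi m j)%R <= M)%N.
  rewrite mulrC size_mulXn -?size_poly_eq0 size_jacobi // addnS.
  by rewrite (leq_ltn_trans _ mnuM) // leq_add2l -ltnS.
rewrite -{1}(npolypK szq).
rewrite {1}(coord_basis (legendre_basis M) (memvf (npolyp M _))).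
rewrite raddf_sum /=; apply: eq_bigr => l _.
by rewrite -(legendre_tupleE l) mxE.
Qed.

Definition jacobi_on (a b : R) (m n : nat) (t : R) : R :=
  (jacobi m n).[(t - a) / (b - a)].

Definition posdefmx (n : nat) (W : 'M[R]_n) : Prop :=
  W^T = W /\ forall v : 'cV[R]_n, v != 0 -> 0 < (v^T *m W *m v) 0 0.

(* Stacks v_0, ..., v_(M-1) into one column, with the index order of [*t]. *)
Definition stack_col (M n : nat) (v : 'I_M -> 'cV[R]_n) : 'cV[R]_(M * n) :=
  \col_k v (mxtens_unindex k).1 (mxtens_unindex k).2 0.

Lemma stack_colE (M n : nat) (v : 'I_M -> 'cV[R]_n) (l : 'I_M) (i : 'I_n) :
  stack_col v (mxtens_index (l, i)) 0 = v l i 0.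
Proof. by rewrite mxE mxtens_indexK. Qed.

End Jacobi.

Section Functionals.
Variable R : realType.
Notation mu := (@lebesgue_measure R).

Definition J (n : nat) (W : 'M[R]_n) (m : nat) (a b : R)
    (f : R -> 'cV[R]_n) : R :=
  \int[mu]_(s in `[a, b])
    (((s - a) / (b - a)) ^+ m * ((f s)^T *m W *m f s) 0 0).

Definition phi (n : nat) (a b : R) (f : R -> 'cV[R]_n) (l : nat) : 'cV[R]_n :=
  \col_i \int[mu]_(s in `[a, b]) (jacobi_on a b 0 l s * f s i 0).

Definition Phi (n M : nat) (a b : R) (f : R -> 'cV[R]_n) : 'cV[R]_(M * n) :=
  stack_col (fun l : 'I_M => phi a b f l).

Definition weight_mx (n : nat) (W : 'M[R]_n) (m nu : nat) :
    'M[R]_(nu.+1 * n, nu.+1 * n) :=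
  diag_mx (\row_(j < nu.+1) (m + 2 * j + 1)%:R) *t W.

End Functionals.

(* Main.v *)
(** With u = (s - a) / (b - a), the polynomials P_(m,j)(u) are orthogonal on
    [a, b] for the weight u^m, with squared norm (b - a) / (m + 2 j + 1) (j-fold
    integration by parts in Rodrigues' formula reduces this to a Beta integral).
    The right-hand side is therefore the sum over j <= nu of
    (m + 2 j + 1) / (b - a) * psi_j^T W psi_j where psi_j is the moment of f
    against u^m P_(m,j)(u), that is the j-th block of (Xi (x) I) Phi, and the
    inequality is Bessel's inequality for f and the form W. *)

Require Import Defs.
From HB Require Import structures.
From mathcomp Require Import all_boot all_order all_algebra.
From mathcomp Require Import mxtens ring.
From mathcomp Require Import all_classical all_reals all_analysis.
Import numFieldNormedType.Exports.
Import Order.TTheory GRing.Theory Num.Theory.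
Local Open Scope classical_set_scope.
Local Open Scope ring_scope.

(** * Kronecker products acting on stacked columns *)

Lemma big_mxtens (V : nmodType) (p q : nat) (F : 'I_(p * q) -> V) :
  \sum_k F k = \sum_i \sum_j F (mxtens_index (i, j)).
Proof.
rewrite pair_big /= (reindex (@mxtens_index p q)) /=; last first.
  by exists (@mxtens_unindex p q) => k _; rewrite (mxtens_indexK, mxtens_unindexK).
by apply: eq_bigr => -[i j].
Qed.

(** Blockwise action of a Kronecker product, needed both for [legendre_mx] tensored with the
    identity and for [weight_mx]. *)
Lemma mul_tens_stack_col (R : numFieldType) (p q r n : nat)
    (A : 'M[R]_(p, q)) (B : 'M[R]_(r, n)) (v : 'I_q -> 'cV[R]_n) :
  (A *t B) *m stack_col v = stack_col (fun j => \sum_l A j l *: (B *m v l)).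
Proof.
apply/matrixP => k c; rewrite ord1 {c}.
case: (mxtens_indexP k) => {k} j i; rewrite stack_colE mxE summxE big_mxtens.
apply: eq_bigr => l _; rewrite !mxE mulr_sumr; apply: eq_bigr => i' _.
by rewrite tensmxE stack_colE mulrA.
Qed.

Lemma tr_stack_col_mul (R : numFieldType) (p n : nat) (v w : 'I_p -> 'cV[R]_n) :
  (stack_col v)^T *m stack_col w = \sum_j (v j)^T *m w j.
Proof.
apply/matrixP => k c; rewrite !ord1 mxE summxE big_mxtens.
apply: eq_bigr => j _; rewrite mxE; apply: eq_bigr => i _.
by rewrite stack_colE ![_^T _ _]mxE stack_colE.
Qed.

(** * Iterated derivatives of polynomials *)

(** Each derivative costs at most one factor [r]. The induction hypothesis is taken at [k.+1], which
    leaves a spare factor for the last derivative. *)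
Lemma dvdp_derivn_exp {R : fieldType} (g r : {poly R}) (k i : nat) :
  r ^+ k %| (g * r ^+ (k + i))^`(i).
Proof.
elim: i k => [|i IH] k; first by rewrite addn0 dvdp_mull.
have /dvdpP[s] := IH k.+1; rewrite derivnS addSnnS => ->.
rewrite derivM deriv_exp /= exprS dvdp_addr; last by rewrite mulrA dvdp_mulIr.
by rewrite -mulr_natr mulrCA -mulrA mulrCA dvdp_mulr.
Qed.

Lemma derivn_small {R : nzRingType} {p : {poly R}} {k : nat} :
  (size p <= k)%N -> p^`(k) = 0.
Proof.
move=> szp; apply/polyP => i; rewrite coef_derivn coef0 nth_default ?mul0rn //.
exact: leq_trans szp (leq_addr _ _).
Qed.

Lemma derivn_size_lead {R : nzRingType} {p : {poly R}} {k : nat} :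
  size p = k.+1 -> p^`(k) = (p`_k *+ k`!)%:P.
Proof.
move=> szp; apply/polyP => -[|i]; rewrite coef_derivn coefC /=.
  by rewrite addn0 ffactnn.
by rewrite nth_default ?mul0rn // szp addnS ltnS leq_addr.
Qed.

(** * Integrals over [a, b] of continuous functions and of polynomials *)

Section Segment.
Variable R : realType.
Notation mu := (@lebesgue_measure R).
Variables (a b : R).
Implicit Types (g h : R -> R) (p q : {poly R}).

Lemma within_continuousM g h : {within `[a, b], continuous g} ->
  {within `[a, b], continuous h} ->
  {within `[a, b], continuous (fun s => g s * h s)}.
Proof. by move=> cg ch x; apply: cvgM; [exact: cg|exact: ch]. Qed.

Lemma within_continuous_sum (I : Type) (r : seq I) (F : I -> R -> R) :
  (forall i, {within `[a, b], continuous (F i)}) ->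
  {within `[a, b], continuous (fun s => \sum_(i <- r) F i s)}.
Proof.
move=> cF; elim: r => [|i r IH].
  rewrite (_ : (fun s => _) = cst 0); last by apply/funext => s; rewrite big_nil.
  by move=> x; exact: cvg_cst.
rewrite (_ : (fun s => _) = fun s => F i s + \sum_(i <- r) F i s); last first.
  by apply/funext => s; rewrite big_cons.
by move=> x; apply: cvgD; [exact: cF|exact: IH].
Qed.

Lemma integrable_segment g : {within `[a, b], continuous g} ->
  mu.-integrable `[a, b] (EFin \o g).
Proof. by apply: continuous_compact_integrable; exact: segment_compact. Qed.

Lemma Rintegral_sumZ (I : Type) (r : seq I) (k : I -> R) (F : I -> R -> R) :
  (forall i, {within `[a, b], continuous (F i)}) ->
  \int[mu]_(s in `[a, b]) (\sum_(i <- r) k i * F i s) =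
  \sum_(i <- r) k i * \int[mu]_(s in `[a, b]) F i s.
Proof.
move=> cF.
have ckF i : {within `[a, b], continuous (fun s => k i * F i s)}.
  by apply: within_continuousM => // x; exact: cvg_cst.
elim: r => [|i r IH].
  rewrite big_nil; under eq_Rintegral do rewrite big_nil.
  by rewrite Rintegral_cst //= mul0r.
rewrite big_cons -IH -RintegralZl //; last exact: integrable_segment.
under eq_Rintegral do rewrite big_cons.
rewrite RintegralD //; apply: integrable_segment => //.
exact: within_continuous_sum.
Qed.

Lemma continuous_horner_affine p :
  continuous (fun s => p.[(s - a) / (b - a)]).
Proof.
move=> x.
apply: (@continuous_comp _ _ _ (fun s => (s - a) / (b - a)) (horner p)).
  by apply: cvgMr_tmp; apply: cvgB; [exact: cvg_id|exact: cvg_cst].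
exact: continuous_horner.
Qed.

Lemma within_continuous_horner_affine p :
  {within `[a, b], continuous (fun s => p.[(s - a) / (b - a)])}.
Proof. by apply: continuous_subspaceT; exact: continuous_horner_affine. Qed.

(** Working in the variable u = (s - a) / (b - a) puts the endpoints at 0 and 1, the roots of X^2 -
    X. *)
Definition ipoly p : R := \int[mu]_(s in `[a, b]) p.[(s - a) / (b - a)].

Lemma ipolyD p q : ipoly (p + q) = ipoly p + ipoly q.
Proof.
rewrite /ipoly -RintegralD //.
- by apply: eq_Rintegral => s _; rewrite hornerD.
- exact/integrable_segment/within_continuous_horner_affine.
- exact/integrable_segment/within_continuous_horner_affine.
Qed.

Lemma ipolyZ c p : ipoly (c *: p) = c * ipoly p.
Proof.
rewrite /ipoly -RintegralZl //.
- by apply: eq_Rintegral => s _; rewrite hornerZ.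
- exact/integrable_segment/within_continuous_horner_affine.
Qed.

Hypothesis lt_ab : a < b.

Lemma ipoly_deriv p : ipoly p^`() = (b - a) * (p.[1] - p.[0]).
Proof.
(* The factor b - a cancels the 1 / (b - a) of the chain rule, so [r] is an antiderivative of the
   integrand. *)
pose r : {poly R} := (b - a) *: (p \Po ((b - a)^-1 *: ('X - a%:P))).
have ba0 : b - a != 0 by rewrite subr_eq0 gt_eqF.
have rE s : r.[s] = (b - a) * p.[(s - a) / (b - a)].
  by rewrite /r hornerZ horner_comp hornerZ hornerXsubC [_^-1 * _]mulrC.
have dr s : r^`().[s] = p^`().[(s - a) / (b - a)].
  rewrite /r derivZ deriv_comp derivZ derivXsubC hornerZ hornerM horner_comp.
  rewrite !hornerZ hornerXsubC hornerC mulr1 mulrCA mulfV // mulr1.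
  by rewrite [_^-1 * _]mulrC.
rewrite /ipoly /Rintegral.
rewrite (@continuous_FTC2 R _ (horner r)) //.
- by rewrite !rE subrr mul0r divff // mulrBr.
- exact: within_continuous_horner_affine.
- split; first by move=> x _; exact: derivable_horner.
  + by apply: cvg_at_right_filter; exact: continuous_horner.
  + by apply: cvg_at_left_filter; exact: continuous_horner.
- by move=> x _; rewrite derive1E -dr; apply: derive_val; exact: is_derive_poly.
Qed.

Lemma ipoly_by_parts p q : root p 0 -> root p 1 ->
  ipoly (p^`() * q) = - ipoly (p * q^`()).
Proof.
move=> /rootP p0 /rootP p1; apply/eqP; rewrite -addr_eq0 -ipolyD -derivM.
by rewrite ipoly_deriv !hornerM p0 p1 !mul0r subrr mulr0.
Qed.

Lemma ipoly_derivn p q k :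
  (forall i, (i < k)%N -> root p^`(i) 0 /\ root p^`(i) 1) ->
  ipoly (p^`(k) * q) = (-1) ^+ k * ipoly (p * q^`(k)).
Proof.
elim: k q => [|k IH] q p01; first by rewrite mul1r.
have [p0 p1] := p01 k (ltnSn k).
rewrite derivnS ipoly_by_parts // IH; last by move=> i ik; apply: p01; exact: ltnW.
by rewrite -derivSn exprS mulN1r mulNr.
Qed.

(** The Beta integral B(k+1, l+1), scaled by b - a. The induction on [l] trades a factor 1 - X for a
    factor X, hence [k] stays general. *)
Lemma ipoly_beta k l : ipoly ('X^k * (1 - 'X) ^+ l) =
  (b - a) * (k`! * l`!)%:R / ((k + l).+1)`!%:R.
Proof.
elim: l k => [|l IH] k.
  have -> : 'X^k * (1 - 'X) ^+ 0 = (k.+1%:R^-1 *: 'X^(k.+1))^`() :> {poly R}.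
    rewrite expr0 mulr1 derivZ derivXn -[X in _ *: X]scaler_nat scalerA.
    by rewrite mulVf ?scale1r ?pnatr_eq0.
  rewrite ipoly_deriv !hornerE expr1n expr0n /= !mulr0 subr0 mulr1.
  rewrite factS natrM.
  by field; rewrite nat1r !pnatr_eq0 -lt0n fact_gt0.
(* The product rule for X^(k+1) (1 - X)^(l+1), solved for its term in X^k. *)
have parts : ('X^k * (1 - 'X) ^+ l.+1 : {poly R}) =
    k.+1%:R^-1 *: (('X^(k.+1) * (1 - 'X) ^+ l.+1)^`() +
                    l.+1%:R *: ('X^(k.+1) * (1 - 'X) ^+ l)).
  rewrite derivM derivXn deriv_exp derivB derivX derivC sub0r /=.
  rewrite mulN1r mulNrn mulrN mulrnAl mulrnAr scaler_nat subrK.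
  by rewrite -[X in _ *: X]scaler_nat scalerA mulVf ?scale1r ?pnatr_eq0.
have D0 : ((k + l.+1).+1)`!%:R != 0 :> R by rewrite pnatr_eq0 -lt0n fact_gt0.
have ends : ('X^(k.+1) * (1 - 'X) ^+ l.+1 : {poly R}).[1] -
            ('X^(k.+1) * (1 - 'X) ^+ l.+1 : {poly R}).[0] = 0.
  by rewrite !hornerE subrr !expr0n /= !mulr0 mul0r subrr.
rewrite parts ipolyZ ipolyD ipolyZ IH addSnnS (factS k) (factS l).
rewrite ipoly_deriv ends mulr0 add0r.
move: (_.+1)`!%:R D0 => D D0; rewrite -!mulnA !natrM.
by field; rewrite D0 nat1r pnatr_eq0.
Qed.

End Segment.

(** * Orthogonality and norms of the Jacobi polynomials *)

Section Orth.
Variables (R : realType) (a b : R) (lt_ab : a < b).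
Local Notation ipoly := (@ipoly R a b).

(** The derivative is still divisible by (X^2 - X)^(j-i), whose exponent is positive. This removes
    the boundary terms of the integration by parts. *)
Lemma root_rodrigues (m j i : nat) (c : R) : (i < j)%N -> root ('X^2 - 'X) c ->
  root ('X^m * ('X^2 - 'X) ^+ j)^`(i) c.
Proof.
move=> ltij rc.
have /dvdpP[s] := dvdp_derivn_exp ('X^m) ('X^2 - 'X : {poly R}) (j - i) i.
rewrite subnK ?(ltnW ltij) // => ->.
by rewrite rootE hornerM horner_exp (rootP rc) expr0n subn_eq0 leqNgt ltij mulr0.
Qed.

Lemma ipoly_jacobi (m j : nat) (q : {poly R}) :
  ipoly ('X^m * jacobi R m j * q) =
  (-1) ^+ j / j`!%:R * ipoly ('X^m * ('X^2 - 'X) ^+ j * q^`(j)).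
Proof.
rewrite mulrC ['X^m * _]mulrC jacobiM -scalerAr ipolyZ [q * _]mulrC.
rewrite ipoly_derivn // => [|i ltij]; first by rewrite mulrCA mulrA.
by split; apply: root_rodrigues => //; rewrite rootE !hornerE ?expr1n ?expr0n subrr.
Qed.

(** The top term X^(m+2j) of X^m (X^2 - X)^j acquires the falling factorial of m + 2j of length j,
    which Rodrigues' formula divides by j!. *)
Lemma coef_jacobi_top m j : (jacobi R m j)`_j = 'C(m + 2 * j, j)%:R.
Proof.
have -> : (jacobi R m j)`_j = (jacobi R m j * 'X^m)`_(m + j).
  by rewrite coefMXn ltnNge leq_addr addKn.
rewrite jacobiM coefZ coef_derivn.
have -> : 'X^2 - 'X = 'X * ('X - 1%:P) :> {poly R} by rewrite mulrBr mulr1 expr2.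
rewrite exprMn mulrA -exprD coefXnM ltnNge leq_addl /= addnK.
have -> : (('X - 1%:P : {poly R}) ^+ j)`_j = 1.
  have /monicP := monic_exp j (monicXsubC (1 : R)).
  by rewrite lead_coefE size_exp_XsubC.
rewrite addnCA addnn -mul2n -bin_ffact natrM mulrC.
by rewrite mulfK // pnatr_eq0 -lt0n fact_gt0.
Qed.

Lemma ipoly_jacobi_orth m j k :
  ipoly ('X^m * jacobi R m j * jacobi R m k) =
  if j == k then (b - a) / (m + 2 * j + 1)%:R else 0.
Proof.
(* Rodrigues' formula is applied to the factor of larger degree, so that the l-th derivative falls
   on the other one and kills it. *)
have lt_orth i l : (i < l)%N -> ipoly ('X^m * jacobi R m l * jacobi R m i) = 0.
  move=> ltil; rewrite ipoly_jacobi derivn_small ?size_jacobi // mulr0.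
  by rewrite -(scale0r 0) ipolyZ mul0r mulr0.
have [ltjk|ltkj|<-] := ltngtP j k; last 1 first; last by exact: lt_orth.
  rewrite ipoly_jacobi (derivn_size_lead (size_jacobi _ _ _)) coef_jacobi_top.
  set c := 'C(m + 2 * j, j)%:R *+ j`!.
  (* X^2 - X = - X (1 - X) gives a Beta integrand; the sign (-1)^j cancels the one from the
     integration by parts. *)
  have -> : 'X^m * ('X^2 - 'X) ^+ j * c%:P =
      ((-1) ^+ j * c) *: ('X^(m + j) * (1 - 'X) ^+ j).
    have -> : 'X^2 - 'X = - ('X * (1 - 'X)) :> {poly R}.
      by rewrite mulrBr mulr1 opprB expr2.
    rewrite (exprNn ('X * _)) exprMn mulrC mul_polyC [(-1) ^+ j * c]mulrC -scalerA.
    congr (_ *: _); rewrite -![(-1) ^+ j]signr_odd exprD.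
    by case: odd; rewrite ?scaleN1r ?scale1r; ring.
  rewrite ipolyZ ipoly_beta // /c -['C(_, _)%:R *+ j`!]mulr_natr.
  have -> : (m + j + j = m + 2 * j)%N by rewrite -addnA addnn mul2n.
  (* With (m+2j)! split this way, everything cancels except the factor m + 2j + 1 of (m+2j+1)!. *)
  have facE : ((m + 2 * j)`!%:R : R) =
      'C(m + 2 * j, j)%:R * (j`!%:R * (m + j)`!%:R).
    rewrite -!natrM -(bin_fact (_ : j <= m + 2 * j)%N).
      by rewrite mul2n -addnn addnA addnK.
    by rewrite mul2n -addnn addnA leq_addl.
  have bin0 : 'C(m + 2 * j, j)%:R != 0 :> R.
    by rewrite pnatr_eq0 -lt0n bin_gt0 mul2n -addnn addnA leq_addl.
  have fac0 l : l`!%:R != 0 :> R by rewrite pnatr_eq0 -lt0n fact_gt0.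
  have N0 : (m + 2 * j).+1%:R != 0 :> R by rewrite pnatr_eq0.
  rewrite addn1 factS [(_ * (m + 2 * j)`!)%:R]natrM facE natrM mulrACA.
  transitivity ((-1) ^+ j * (-1) ^+ j * ((b - a) / (m + 2 * j).+1%:R)); last first.
    by rewrite -expr2 sqrr_sign mul1r.
  move: (j`!%:R) (fac0 j) ((m + j)`!%:R) (fac0 (m + j)%N) => x x0 y y0.
  move: ('C(_, _)%:R) bin0 (_.+1%:R) N0 ((-1) ^+ j) => C C0 N N0 e.
  by field; rewrite N0 y0 x0 C0.
(* The remaining case j < k, by exchanging the two polynomials. *)
by rewrite mulrAC lt_orth.
Qed.

End Orth.

(** * Bessel's inequality for the form W *)

Section Bessel.
Variables (R : realType) (n : nat) (W : 'M[R]_n) (W_posdef : posdefmx W).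
Variables (a b : R) (lt_ab : a < b) (m : nat).
Variables (f : R -> 'cV[R]_n) (f_cont : {within `[a, b], continuous f}).
Notation mu := (@lebesgue_measure R).

Definition mxform (x y : 'cV[R]_n) : R := (x^T *m W *m y) 0 0.

Lemma mxformE (x y : 'cV[R]_n) :
  mxform x y = \sum_i (x^T *m W) 0 i * y i 0.
Proof. by rewrite /mxform mxE. Qed.

Lemma mxformC (x y : 'cV[R]_n) : mxform x y = mxform y x.
Proof.
transitivity ((y^T *m W *m x)^T 0 0); last by rewrite mxE.
by rewrite !trmx_mul trmxK W_posdef.1 mulmxA.
Qed.

Lemma mxform_ge0 (x : 'cV[R]_n) : 0 <= mxform x x.
Proof.
have [->|x0] := eqVneq x 0; first by rewrite /mxform mulmx0 mxE.
exact/ltW/W_posdef.2.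
Qed.

Lemma mxform_suml (I : Type) (r : seq I) (k : I -> R) (x : I -> 'cV[R]_n) y :
  mxform (\sum_(i <- r) k i *: x i) y = \sum_(i <- r) k i * mxform (x i) y.
Proof.
rewrite /mxform raddf_sum /= !mulmx_suml summxE; apply: eq_bigr => i _.
by rewrite linearZ /= -!scalemxAl mxE.
Qed.

Lemma mxform_sumr (I : Type) (r : seq I) (k : I -> R) (x : I -> 'cV[R]_n) y :
  mxform y (\sum_(i <- r) k i *: x i) = \sum_(i <- r) k i * mxform y (x i).
Proof. by rewrite mxformC mxform_suml; apply: eq_bigr => i _; rewrite mxformC. Qed.

(** Bracketed so that for x = f and y = h, its projection, the second difference has weighted
    integral zero. *)
Lemma mxform_subr (x y : 'cV[R]_n) :
  mxform (x - y) (x - y) = (mxform x x - mxform y x) - (mxform y x - mxform y y).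
Proof.
rewrite {2}[mxform y x]mxformC /mxform [(x - y)^T]linearB /=.
by rewrite !mulmxBr !mulmxBl !mxE.
Qed.

Lemma within_continuous_coord i : {within `[a, b], continuous (fun s => f s i 0)}.
Proof.
apply: (@within_continuous_comp _ _ _ _ f (fun v : 'cV[R]_n => v i 0)) => //.
by move=> v _; exact: coord_continuous.
Qed.

(** The vector psi_j: an unnormalised Fourier coefficient of f. *)
Definition jacobi_moment (j : nat) : 'cV[R]_n :=
  \col_i \int[mu]_(s in `[a, b])
    (('X^m * jacobi R m j).[(s - a) / (b - a)] * f s i 0).

(** Linearity of the integral applied to [legendre_mxP]; the degree bound ensures that the Legendre
    expansion is exact. *)
Lemma jacobi_moment_legendre (M nu : nat) (j : 'I_nu.+1) : (m + nu < M)%N ->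
  jacobi_moment j = \sum_(l < M) legendre_mx R m nu M j l *: phi a b f l.
Proof.
move=> mnuM; apply/matrixP => i c; rewrite ord1 {c} mxE summxE.
rewrite (legendre_mxP R j mnuM).
transitivity (\sum_(l < M) legendre_mx R m nu M j l *
    \int[mu]_(s in `[a, b]) (jacobi_on a b 0 l s * f s i 0)); last first.
  by apply: eq_bigr => l _; rewrite [RHS]mxE; congr (_ * _); rewrite mxE.
apply: etrans; last first; first apply: Rintegral_sumZ => l.
  apply: within_continuousM; last exact: within_continuous_coord.
  exact: within_continuous_horner_affine.
apply: eq_Rintegral => s _; rewrite horner_sum mulr_suml.
by apply: eq_bigr => l _; rewrite hornerZ mulrA.
Qed.

Variable nu : nat.

Let c (j : nat) : R := (m + 2 * j + 1)%:R / (b - a).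
Let u (s : R) := (s - a) / (b - a).
(* The orthogonal projection of f: [c j] is the inverse of the squared norm of
   the j-th orthogonal polynomial. *)
Let h (s : R) : 'cV[R]_n :=
  \sum_(j < nu.+1) (c j * (jacobi R m j).[u s]) *: jacobi_moment j.

(** The common value of the pairings of h with f and with itself; they agree because f - h is
    orthogonal to h. *)
Let S := \sum_(j < nu.+1) c j * mxform (jacobi_moment j) (jacobi_moment j).

(** No orthogonality enters: integrating u^m P_(m,j)(u) f(s) coordinatewise reproduces psi_j. *)
Let int_hf : \int[mu]_(s in `[a, b]) (u s ^+ m * mxform (h s) (f s)) = S.
Proof.
transitivity (\int[mu]_(s in `[a, b]) (\sum_(j < nu.+1) c j *
    \sum_i ((jacobi_moment j)^T *m W) 0 i *
      (('X^m * jacobi R m j).[u s] * f s i 0))).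
  apply: eq_Rintegral => s _; rewrite mxform_suml mulr_sumr; apply: eq_bigr => j _.
  rewrite mxformE hornerM hornerXn !mulr_sumr; apply: eq_bigr => i _; ring.
have cF i j : {within `[a, b], continuous (fun s =>
    ('X^m * jacobi R m j).[u s] * f s i 0)}.
  apply: within_continuousM; last exact: within_continuous_coord.
  exact: within_continuous_horner_affine.
rewrite Rintegral_sumZ; last first.
  move=> j; apply: within_continuous_sum => i; apply: within_continuousM => //.
  by move=> x; exact: cvg_cst.
apply: eq_bigr => j _; rewrite Rintegral_sumZ // mxformE.
by congr (_ * _); apply: eq_bigr => i _; congr (_ * _); rewrite mxE.
Qed.

Let int_hh : \int[mu]_(s in `[a, b]) (u s ^+ m * mxform (h s) (h s)) = S.
Proof.
transitivity (\int[mu]_(s in `[a, b]) (\sum_(j < nu.+1) c j *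
    \sum_(k < nu.+1) (c k * mxform (jacobi_moment j) (jacobi_moment k)) *
      ('X^m * jacobi R m j * jacobi R m k).[u s])).
  apply: eq_Rintegral => s _; rewrite mxform_suml mulr_sumr; apply: eq_bigr => j _.
  rewrite mxform_sumr !mulr_sumr; apply: eq_bigr => k _.
  by rewrite !hornerM hornerXn; ring.
have cF j k : {within `[a, b], continuous (fun s =>
    ('X^m * jacobi R m j * jacobi R m k).[u s])}.
  exact: within_continuous_horner_affine.
rewrite Rintegral_sumZ; last first.
  move=> j; apply: within_continuous_sum => i; apply: within_continuousM => //.
  by move=> x; exact: cvg_cst.
apply: eq_bigr => j _; rewrite Rintegral_sumZ //; congr (_ * _).
have ba0 : b - a != 0 by rewrite subr_eq0 gt_eqF.
(* Orthogonality leaves only k = j, where [c j] cancels the squared norm. *)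
rewrite (bigD1 j) //= big1 => [|k kj];
  rewrite -/(ipoly R a b _) ipoly_jacobi_orth //.
  have N0 : (m + 2 * j + 1)%:R != 0 :> R by rewrite pnatr_eq0 addn1.
  rewrite eqxx addr0 /c; move: (_ + 1)%:R N0 => N N0.
  by field; rewrite N0 ba0.
by rewrite eq_sym val_eqE (negPf kj) mulr0.
Qed.

Lemma bessel :
  \sum_(j < nu.+1) (m + 2 * j + 1)%:R / (b - a) *
    mxform (jacobi_moment j) (jacobi_moment j) <= J W m a b f.
Proof.
have cu : {within `[a, b], continuous (fun s => u s ^+ m)}.
  rewrite (_ : (fun s => _) = fun s => 'X^m.[u s]).
    exact: within_continuous_horner_affine.
  by apply/funext => s; rewrite hornerXn.
(* Continuity is asked of the coordinates only, since the form is a finite sum of products of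
   them. *)
have cform (g k : R -> 'cV[R]_n) :
    (forall i, {within `[a, b], continuous (fun s => g s i 0)}) ->
    (forall i, {within `[a, b], continuous (fun s => k s i 0)}) ->
    {within `[a, b], continuous (fun s => u s ^+ m * mxform (g s) (k s))}.
  move=> cg ck; apply: within_continuousM => //.
  rewrite (_ : (fun s => _) =
    fun s => \sum_i (\sum_j g s j 0 * W j i) * k s i 0); last first.
    apply/funext => s; rewrite mxformE; apply: eq_bigr => i _; rewrite mxE.
    by congr (_ * _); apply: eq_bigr => j _; rewrite mxE.
  apply: within_continuous_sum => i; apply: within_continuousM => //.
  apply: within_continuous_sum => j; apply: within_continuousM => //.
  by move=> x; exact: cvg_cst.
have ch i : {within `[a, b], continuous (fun s => h s i 0)}.
  rewrite (_ : (fun s => _) =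
    fun s => \sum_(j < nu.+1) c j * (jacobi R m j).[u s] * jacobi_moment j i 0);
    last first.
    by apply/funext => s; rewrite summxE; apply: eq_bigr => j _; rewrite mxE.
  apply: within_continuous_sum => j; apply: within_continuousM; last first.
    by move=> x; exact: cvg_cst.
  apply: within_continuousM; last exact: within_continuous_horner_affine.
  by move=> x; exact: cvg_cst.
have cf := within_continuous_coord.
(* Here a < b makes u, hence the weight u^m, nonnegative on [a, b]. Expanding the form turns this
   into 0 <= (J - S) - (S - S). *)
have : 0 <= \int[mu]_(s in `[a, b]) (u s ^+ m * mxform (f s - h s) (f s - h s)).
  apply: Rintegral_ge0 => s /=; rewrite in_itv /= => /andP[las lsb].
  rewrite mulr_ge0 ?mxform_ge0 // exprn_ge0 // divr_ge0 // subr_ge0 //.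
  exact: ltW.
under eq_Rintegral do rewrite mxform_subr !mulrBr.
rewrite !RintegralB //; try by apply: integrable_segment; exact: cform.
- by rewrite int_hf int_hh subrr subr0 subr_ge0.
- by apply: integrable_segment; apply: within_continuousB; exact: cform.
- by apply: integrable_segment; apply: within_continuousB; exact: cform.
Qed.

End Bessel.

(** * From Bessel's inequality to the matrix form *)

Theorem lemma2 (R : realType) (n : nat) (n_ge1 : (1 <= n)%N)
  (W : 'M[R]_n) (W_posdef : posdefmx W)
  (a b : R) (lt_ab : a < b)
  (m M nu : nat) (M_gt0 : (0 < M)%N) (le_mnu : (m + nu <= M - 1)%N)
  (f : R -> 'cV[R]_n) (f_cont : {within `[a, b], continuous f}) :
  J W m a b f >=
    (b - a)^-1 *
    ((Phi M a b f)^T *m (legendre_mx R m nu M *t (1%:M : 'M[R]_n))^T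
     *m weight_mx W m nu
     *m (legendre_mx R m nu M *t (1%:M : 'M[R]_n)) *m Phi M a b f) 0 0.
Proof.
(* [M - 1] is truncated subtraction; positivity of [M] makes the bound strict. *)
have mnuM : (m + nu < M)%N by rewrite -(prednK M_gt0) ltnS -subn1.
set L := _ *t 1%:M.
have LPhi : L *m Phi M a b f =
    stack_col (fun j : 'I_nu.+1 => jacobi_moment R n a b m f j).
  rewrite mul_tens_stack_col; congr stack_col; apply/funext => j.
  rewrite (jacobi_moment_legendre _ _ _ _ _ _ f_cont _ _ _ mnuM).
  by apply: eq_bigr => l _; rewrite mul1mx.
(* The right-hand side is regrouped as a quadratic form in L Phi and then split into blocks. *)
rewrite -!mulmxA LPhi mulmxA -trmx_mul LPhi mul_tens_stack_col tr_stack_col_mul.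
apply: le_trans (bessel _ _ _ W_posdef _ _ lt_ab _ _ f_cont nu).
rewrite summxE mulr_sumr; apply: ler_sum => j _.
(* The diagonal factor of [weight_mx] keeps only the block of index j. *)
rewrite (bigD1 j) //= big1 => [|k kj]; last first.
  by rewrite !mxE eq_sym (negPf kj) scale0r.
rewrite addr0 [diag_mx _ _ _]mxE eqxx [(\row_j _) _ _]mxE mulr1n.
by rewrite -scalemxAr mulmxA [X in _ * X]mxE mulrA [_^-1 * _]mulrC.
Qed.
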